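(* Let $\Bbbk$ be a field, let $\mathcal T$ be a finite vacant double groupoid and let $(\sigma,\tau)$ be a normalized 2-cocycle on $\mathcal T$ with values in $\Bbbk^\times$. Then the quantum groupoid $\Bbbk{}^{\tau}_{\sigma}\mathcal T$ is involutory, i.e. its antipode satisfies $\mathcal S^2=\mathrm{id}$. If $\operatorname{char}\Bbbk=0$, then $\Bbbk{}^{\tau}_{\sigma}\mathcal T$ is semisimple and cosemisimple.
   Context: Convention: in a category, $fg$ means ''first $f$, then $g$'' (defined when target of $f$ = source of $g$). Double categories. A (small) double category $\mathcal T$ consists of non-empty sets $\mathcal B$ (boxes), $\mathcal H$ (horizontal edges), $\mathcal V$ (vertical edges), $\mathcal P$ (points) and four categories: (arrows $\mathcal B$, objects $\mathcal H$, source $t$, target $b$), whose composition is called vertical; (arrows $\mathcal B$, objects $\mathcal V$, source $l$, target $r$), whose composition is called horizontal; (arrows $\mathcal H$, objects $\mathcal P$, source $l$, target $r$); (arrows $\mathcal V$, objects $\mathcal P$, source $t$, target $b$). Write $A\circ_v B$ ($A$ on top of $B$) for the vertical composite, defined when $b(A)=t(B)$, and $AB$ for the horizontal composite, defined when $r(A)=l(B)$. Write $\mathrm{id}_P$ for the identities in $\mathcal H$ and in $\mathcal V$ at $P\in\mathcal P$; for $x\in\mathcal H$, $\mathbf{id}_x\in\mathcal B$ is the identity of $x$ for vertical composition (a ''vertical identity''); for $g\in\mathcal V$, $\mathbf{id}_g\in\mathcal B$ is the identity of $g$ for horizontal composition (a ''horizontal identity''). Axioms: (1) $tr=rt$, $tl=lt$,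 $bl=lb$, $br=rb$ as maps $\mathcal B\to\mathcal P$; (2) $t(AB)=t(A)t(B)$, $b(AB)=b(A)b(B)$, $l(A\circ_v B)=l(A)l(B)$, $r(A\circ_v B)=r(A)r(B)$; (3) interchange: $(AB)\circ_v(CD)=(A\circ_v C)(B\circ_v D)$ whenever $r(A)=l(B)$, $r(C)=l(D)$, $b(A)=t(C)$, $b(B)=t(D)$; (4) for $x\in\mathcal H$, $l(\mathbf{id}_x)=\mathrm{id}_{l(x)}$, $r(\mathbf{id}_x)=\mathrm{id}_{r(x)}$; for $g\in\mathcal V$, $t(\mathbf{id}_g)=\mathrm{id}_{t(g)}$, $b(\mathbf{id}_g)=\mathrm{id}_{b(g)}$; (5) for $P\in\mathcal P$ the vertical identity of the horizontal edge $\mathrm{id}_P$ equals the horizontal identity of the vertical edge $\mathrm{id}_P$; (6) $\mathbf{id}_g\circ_v\mathbf{id}_h=\mathbf{id}_{gh}$ for composable $g,h\in\mathcal V$ and $\mathbf{id}_x\mathbf{id}_y=\mathbf{id}_{xy}$ for composable $x,y\in\mathcal H$. A double groupoid is a double category all four of whose categories are groupoids. $A^h$, $A^v$ denote the inverses of a box $A$ for horizontal and vertical composition, and $A^{-1}:=(A^h)^v=(A^v)^h$. It is finite if $\mathcal B,\mathcal H,\mathcal V,\mathcal P$ are finite. It is vacant if for all $g\in\mathcal V$, $x\in\mathcal H$ with $r(x)=t(g)$ there is exactly one $X\in\mathcal B$ with $t(X)=x$, $r(X)=g$. Normalized 2-cocycle on $\mathcal T$ with values in $\Bbbk^\times$: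 a pair $(\sigma,\tau)$ where $\sigma$ is a $\Bbbk^\times$-valued function on pairs $(A,B)$ of boxes with $b(A)=t(B)$, and $\tau$ a $\Bbbk^\times$-valued function on pairs $(A,B)$ with $r(A)=l(B)$, such that: $\sigma(A,B)\sigma(A\circ_v B,C)=\sigma(B,C)\sigma(A,B\circ_v C)$ for vertically composable $A,B,C$; $\sigma(A,B)=1$ if $A$ or $B$ is a vertical identity; $\tau(A,B)\tau(AB,C)=\tau(B,C)\tau(A,BC)$ for horizontally composable $A,B,C$; $\tau(A,B)=1$ if $A$ or $B$ is a horizontal identity; and, whenever $r(A)=l(B)$, $r(C)=l(D)$, $b(A)=t(C)$, $b(B)=t(D)$, $\sigma(AB,CD)\,\tau(A\circ_v C,B\circ_v D)=\tau(A,B)\tau(C,D)\sigma(A,C)\sigma(B,D)$. $\Bbbk{}^{\tau}_{\sigma}\mathcal T$ is the vector space with basis $\mathcal B$ with: $A.B=\sigma(A,B)\,A\circ_v B$ if $b(A)=t(B)$, and $0$ otherwise; unit $\mathbf 1=\sum_{x\in\mathcal H}\mathbf{id}_x$; $\Delta(A)=\sum\tau(B,C)\,B\otimes C$ over pairs with $r(B)=l(C)$, $BC=A$; $\varepsilon(A)=1$ if $A$ is a horizontal identity and $0$ otherwise; antipode $\mathcal S(A)=\tau(A,A^h)^{-1}\sigma(A^{-1},A^h)^{-1}A^{-1}$. With this structure it is a quantum groupoid (weak Hopf algebra). Semisimple means semisimple as an algebra; cosemisimple means cosemisimple as a coalgebra (i.e. the dual algebra is semisimple). *)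

(* Defs.v *)
From HB Require Import structures.
From mathcomp Require Import all_boot ssralg vector falgebra.

Set Implicit Arguments.
Unset Strict Implicit.
Unset Printing Implicit Defensive.

Import GRing.Theory.
Local Open Scope ring_scope.

(* Composition is in diagrammatic order: [catcomp f g] is "first f, then g". *)
(* It is total, but unconstrained (and never used) unless [tgt f = src g].    *)
Record category (O A : Type) := Category {
  src : A -> O;
  tgt : A -> O;
  idm : O -> A;
  catcomp : A -> A -> A;
  src_idm : forall x, src (idm x) = x;
  tgt_idm : forall x, tgt (idm x) = x;
  src_comp : forall f g, tgt f = src g -> src (catcomp f g) = src f;
  tgt_comp : forall f g, tgt f = src g -> tgt (catcomp f g) = tgt g;
  comp_idl : forall f, catcomp (idm (src f)) f = f;
  comp_idr : forall f, catcomp f (idm (tgt f)) = f;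
  catcompA : forall f g h, tgt f = src g -> tgt g = src h ->
    catcomp (catcomp f g) h = catcomp f (catcomp g h) }.

Definition inverse_op (O A : Type) (C : category O A) (inv : A -> A) : Prop :=
  forall f, [/\ src C (inv f) = tgt C f, tgt C (inv f) = src C f,
    catcomp C f (inv f) = idm C (src C f) & catcomp C (inv f) f = idm C (tgt C f)].

(* Boxes B, horizontal edges H, vertical edges V, points P. *)
Record double_data (B H V P : Type) := DoubleData {
  vcat : category H B;    (* source = top,  target = bottom *)
  hcat : category V B;    (* source = left, target = right  *)
  hedge : category P H;   (* source = left, target = right  *)
  vedge : category P V }. (* source = top,  target = bottom *)

Section DoubleNotions.
Context (B H V P : Type) (D : double_data B H V P).

Definition top : B -> H := src (vcat D).
Definition bot : B -> H := tgt (vcat D).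
Definition lft : B -> V := src (hcat D).
Definition rgt : B -> V := tgt (hcat D).
Definition vcomp : B -> B -> B := catcomp (vcat D).
Definition hcomp : B -> B -> B := catcomp (hcat D).
Definition vid : H -> B := idm (vcat D).
Definition hid : V -> B := idm (hcat D).

Definition hl : H -> P := src (hedge D).
Definition hr : H -> P := tgt (hedge D).
Definition vt : V -> P := src (vedge D).
Definition vb : V -> P := tgt (vedge D).

End DoubleNotions.

Record double_category (B H V P : Type) := DoubleCategory {
  ddata :> double_data B H V P;
  nonempty_sets : [/\ inhabited B, inhabited H, inhabited V & inhabited P];
  corner_tr : forall A, vt ddata (rgt ddata A) = hr ddata (top ddata A);
  corner_tl : forall A, vt ddata (lft ddata A) = hl ddata (top ddata A);
  corner_bl : forall A, vb ddata (lft ddata A) = hl ddata (bot ddata A);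
  corner_br : forall A, vb ddata (rgt ddata A) = hr ddata (bot ddata A);
  top_hcomp : forall A C, rgt ddata A = lft ddata C ->
    top ddata (hcomp ddata A C) = catcomp (hedge ddata) (top ddata A) (top ddata C);
  bot_hcomp : forall A C, rgt ddata A = lft ddata C ->
    bot ddata (hcomp ddata A C) = catcomp (hedge ddata) (bot ddata A) (bot ddata C);
  lft_vcomp : forall A C, bot ddata A = top ddata C ->
    lft ddata (vcomp ddata A C) = catcomp (vedge ddata) (lft ddata A) (lft ddata C);
  rgt_vcomp : forall A C, bot ddata A = top ddata C ->
    rgt ddata (vcomp ddata A C) = catcomp (vedge ddata) (rgt ddata A) (rgt ddata C);
  interchange_law : forall A A' C C',
    rgt ddata A = lft ddata A' -> rgt ddata C = lft ddata C' ->
    bot ddata A = top ddata C -> bot ddata A' = top ddata C' ->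
    vcomp ddata (hcomp ddata A A') (hcomp ddata C C') =
    hcomp ddata (vcomp ddata A C) (vcomp ddata A' C');
  lft_vid : forall x, lft ddata (vid ddata x) = idm (vedge ddata) (hl ddata x);
  rgt_vid : forall x, rgt ddata (vid ddata x) = idm (vedge ddata) (hr ddata x);
  top_hid : forall g, top ddata (hid ddata g) = idm (hedge ddata) (vt ddata g);
  bot_hid : forall g, bot ddata (hid ddata g) = idm (hedge ddata) (vb ddata g);
  vid_hid : forall p,
    vid ddata (idm (hedge ddata) p) = hid ddata (idm (vedge ddata) p);
  vcomp_hid : forall g h, vb ddata g = vt ddata h ->
    vcomp ddata (hid ddata g) (hid ddata h) = hid ddata (catcomp (vedge ddata) g h);
  hcomp_vid : forall x y, hr ddata x = hl ddata y ->
    hcomp ddata (vid ddata x) (vid ddata y) = vid ddata (catcomp (hedge ddata) x y) }.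

Record double_groupoid (B H V P : Type) := DoubleGroupoid {
  dcat :> double_category B H V P;
  vinv : B -> B;
  hinv : B -> B;
  hedge_inv : H -> H;
  vedge_inv : V -> V;
  vinvP : inverse_op (vcat dcat) vinv;
  hinvP : inverse_op (hcat dcat) hinv;
  hedge_invP : inverse_op (hedge dcat) hedge_inv;
  vedge_invP : inverse_op (vedge dcat) vedge_inv }.

Definition dinv (B H V P : Type) (T : double_groupoid B H V P) (A : B) : B :=
  vinv T (hinv T A).

Definition vacant (B H V P : Type) (T : double_groupoid B H V P) : Prop :=
  forall (g : V) (x : H), hr T x = vt T g ->
    exists! X : B, top T X = x /\ rgt T X = g.

(* Only the values of sigma (resp. tau) on vertically (resp. horizontally)    *)
(* composable pairs are constrained, and only these are ever used.            *)
Record cocycle2 (K : fieldType) (B H V P : Type) (T : double_groupoid B H V P) :=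
  Cocycle2 {
  sigma : B -> B -> K;
  tau : B -> B -> K;
  sigma_neq0 : forall A C, bot T A = top T C -> sigma A C != 0;
  tau_neq0 : forall A C, rgt T A = lft T C -> tau A C != 0;
  sigma_cocycle : forall A C E, bot T A = top T C -> bot T C = top T E ->
    sigma A C * sigma (vcomp T A C) E = sigma C E * sigma A (vcomp T C E);
  sigma_vidl : forall x A, bot T (vid T x) = top T A -> sigma (vid T x) A = 1;
  sigma_vidr : forall x A, bot T A = top T (vid T x) -> sigma A (vid T x) = 1;
  tau_cocycle : forall A C E, rgt T A = lft T C -> rgt T C = lft T E ->
    tau A C * tau (hcomp T A C) E = tau C E * tau A (hcomp T C E);
  tau_hidl : forall g A, rgt T (hid T g) = lft T A -> tau (hid T g) A = 1;
  tau_hidr : forall g A, rgt T A = lft T (hid T g) -> tau A (hid T g) = 1;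
  sigma_tau : forall A A' C C',
    rgt T A = lft T A' -> rgt T C = lft T C' ->
    bot T A = top T C -> bot T A' = top T C' ->
    sigma (hcomp T A A') (hcomp T C C') * tau (vcomp T A C) (vcomp T A' C') =
    tau A A' * tau C C' * sigma A C * sigma A' C' }.

Section FreeModule.
Context (K : fieldType) (I : finType).

(* The vector space with basis I is {ffun I -> K^o}. *)
Definition bas (i : I) : {ffun I -> K^o} := [ffun j => (j == i)%:R].

(* Linear extension of a function given on the basis. *)
Definition lext (W : lmodType K) (F : I -> W) (x : {ffun I -> K^o}) : W :=
  \sum_i (x i : K) *: F i.

Lemma lext_is_linear (W : lmodType K) (F : I -> W) : linear (lext F).
Proof.
move=> a x y; rewrite /lext scaler_sumr -big_split; apply: eq_bigr => i _ /=.
by rewrite !ffunE scalerDl scalerA.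
Qed.

HB.instance Definition _ (W : lmodType K) (F : I -> W) :=
  GRing.isLinear.Build K {ffun I -> K^o} W *:%R (lext F) (lext_is_linear F).

Lemma lext_bas (W : lmodType K) (F : I -> W) i : lext F (bas i) = F i.
Proof.
rewrite /lext (bigD1 i) //= big1 => [|j /negPf ne]; rewrite ffunE ?ne ?scale0r //.
by rewrite eqxx scale1r addr0.
Qed.

Lemma lext_id x : lext bas x = x.
Proof.
apply/ffunP => j; rewrite sum_ffunE (bigD1 j) //= big1 => [|i ne];
  rewrite !ffunE; last by rewrite eq_sym (negPf ne) scaler0.
by rewrite eqxx addr0 /GRing.scale /= mulr1.
Qed.

Lemma lextE (x : {ffun I -> K^o}) : x = \sum_i (x i : K) *: bas i.
Proof. exact: esym (lext_id x). Qed.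

Lemma eq_on_bas (W : lmodType K) (f g : {linear {ffun I -> K^o} -> W}) :
  (forall i, f (bas i) = g (bas i)) -> f =1 g.
Proof.
move=> fg x; rewrite [x]lextE !linear_sum; apply: eq_bigr => i _.
by rewrite !linearZ fg.
Qed.

End FreeModule.

(* Algebra and coalgebra structures on the space spanned by the arrows of a   *)
(* finite category C, twisted by s.                                           *)
Section Twisted.
Context (K : fieldType) (O A : finType) (C : category O A) (s : A -> A -> K).

Definition tw_basmul (f g : A) : {ffun A -> K^o} :=
  if tgt C f == src C g then s f g *: bas K (catcomp C f g) else 0.
Definition tw_mul (x y : {ffun A -> K^o}) : {ffun A -> K^o} :=
  lext (fun f => lext (fun g => tw_basmul f g) y) x.
Definition tw_one : {ffun A -> K^o} := \sum_x bas K (idm C x).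

(* The tensor square is the vector space with basis A * A, the pair (f, g)    *)
(* standing for the tensor product of f and g.                                *)
Definition tw_comul : {ffun A -> K^o} -> {ffun A * A -> K^o} :=
  lext (fun f => \sum_(p : A * A | (tgt C p.1 == src C p.2)
                                   && (catcomp C p.1 p.2 == f))
                   s p.1 p.2 *: bas K p).
Definition tw_counit : {ffun A -> K^o} -> K^o :=
  lext (fun f => [exists x, f == idm C x]%:R : K^o).

Hypothesis sA : forall f g h, tgt C f = src C g -> tgt C g = src C h ->
  s f g * s (catcomp C f g) h = s g h * s f (catcomp C g h).
Hypothesis s1l : forall x f, tgt C (idm C x) = src C f -> s (idm C x) f = 1.
Hypothesis s1r : forall x f, tgt C f = src C (idm C x) -> s f (idm C x) = 1.

Lemma tw_mulE x y :
  tw_mul x y = \sum_f \sum_g ((x f : K) * (y g : K)) *: tw_basmul f g.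
Proof.
apply: eq_bigr => f _; rewrite scaler_sumr; apply: eq_bigr => g _.
by rewrite scalerA.
Qed.

Lemma tw_mulPl a x x' y : tw_mul (a *: x + x') y = a *: tw_mul x y + tw_mul x' y.
Proof. exact: linearP. Qed.

Lemma tw_mulPr a x y y' : tw_mul x (a *: y + y') = a *: tw_mul x y + tw_mul x y'.
Proof.
rewrite !tw_mulE scaler_sumr -big_split; apply: eq_bigr => f _ /=.
rewrite scaler_sumr -big_split; apply: eq_bigr => g _ /=.
by rewrite scalerA -scalerDl !ffunE mulrDr mulrCA.
Qed.

Lemma tw_mulDl : left_distributive tw_mul +%R.
Proof. by move=> x y z; rewrite -[x]scale1r tw_mulPl !scale1r. Qed.
Lemma tw_mulDr : right_distributive tw_mul +%R.
Proof. by move=> x y z; rewrite -[y]scale1r tw_mulPr !scale1r. Qed.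
Lemma tw_mul0x x : tw_mul 0 x = 0. Proof. exact: linear0. Qed.
Lemma tw_mulx0 x : tw_mul x 0 = 0.
Proof. by apply: (addrI (tw_mul x 0)); rewrite -tw_mulDr !addr0. Qed.
Lemma tw_mulZl a x y : tw_mul (a *: x) y = a *: tw_mul x y.
Proof. by rewrite -[a *: x]addr0 tw_mulPl tw_mul0x addr0. Qed.
Lemma tw_mulZr a x y : tw_mul x (a *: y) = a *: tw_mul x y.
Proof. by rewrite -[a *: y]addr0 tw_mulPr tw_mulx0 addr0. Qed.

Lemma tw_mul_suml (J : finType) (F : J -> {ffun A -> K^o}) y :
  tw_mul (\sum_j F j) y = \sum_j tw_mul (F j) y.
Proof.
by apply: (big_morph (tw_mul^~ y)) => [u v|]; rewrite ?tw_mulDl ?tw_mul0x.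
Qed.
Lemma tw_mul_sumr (J : finType) (F : J -> {ffun A -> K^o}) x :
  tw_mul x (\sum_j F j) = \sum_j tw_mul x (F j).
Proof.
by apply: (big_morph (tw_mul x)) => [u v|]; rewrite ?tw_mulDr ?tw_mulx0.
Qed.

Lemma tw_mul_bas f g : tw_mul (bas K f) (bas K g) = tw_basmul f g.
Proof. by rewrite /tw_mul !lext_bas. Qed.

Lemma tw_basmulA f g h :
  tw_mul (bas K f) (tw_basmul g h) = tw_mul (tw_basmul f g) (bas K h).
Proof.
rewrite /tw_basmul; case: eqP => [gh|ngh]; case: eqP => [fg|nfg];
  rewrite ?(tw_mulZl, tw_mulZr, tw_mul0x, tw_mulx0) ?tw_mul_bas /tw_basmul //.
- rewrite src_comp // tgt_comp // fg gh !eqxx !scalerA catcompA //.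
  by rewrite sA.
- by rewrite src_comp //; case: eqP nfg; rewrite ?scaler0.
- by rewrite tgt_comp //; case: eqP ngh; rewrite ?scaler0.
Qed.

Lemma tw_mul_expandl x y : tw_mul x y = \sum_f (x f : K) *: tw_mul (bas K f) y.
Proof.
rewrite {1}[x]lextE tw_mul_suml; apply: eq_bigr => f _; exact: tw_mulZl.
Qed.

Lemma tw_mul_expandr x y : tw_mul x y = \sum_f (y f : K) *: tw_mul x (bas K f).
Proof.
rewrite {1}[y]lextE tw_mul_sumr; apply: eq_bigr => f _; exact: tw_mulZr.
Qed.

Lemma tw_mulA : associative tw_mul.
Proof.
move=> x y z; rewrite (tw_mul_expandl x (tw_mul y z)) (tw_mul_expandl x y).
rewrite [RHS]tw_mul_suml; apply: eq_bigr => f _.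
rewrite tw_mulZl; congr (_ *: _).
rewrite (tw_mul_expandl y z) (tw_mul_expandr (bas K f) y).
rewrite [RHS]tw_mul_suml [LHS]tw_mul_sumr; apply: eq_bigr => g _.
rewrite tw_mulZl tw_mulZr; congr (_ *: _).
rewrite (tw_mul_expandr (bas K g) z) [LHS]tw_mul_sumr [RHS]tw_mul_expandr.
by apply: eq_bigr => h _; rewrite tw_mulZr !tw_mul_bas tw_basmulA.
Qed.

Lemma tw_mul1x : left_id tw_one tw_mul.
Proof.
move=> x; rewrite tw_mul_expandr [RHS]lextE.
apply: eq_bigr => f _; congr (_ *: _).
rewrite /tw_one tw_mul_suml (bigD1 (src C f)) //= big1 => [|y ne];
  rewrite tw_mul_bas /tw_basmul tgt_idm; last by rewrite (negPf ne).
by rewrite eqxx s1l ?tgt_idm // comp_idl scale1r addr0.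
Qed.

Lemma tw_mulx1 : right_id tw_one tw_mul.
Proof.
move=> x; rewrite tw_mul_expandl [RHS]lextE.
apply: eq_bigr => f _; congr (_ *: _).
rewrite /tw_one tw_mul_sumr (bigD1 (tgt C f)) //= big1 => [|y ne];
  rewrite tw_mul_bas /tw_basmul src_idm; last by rewrite eq_sym (negPf ne).
by rewrite eqxx s1r ?src_idm // comp_idr scale1r addr0.
Qed.

Lemma tw_oneE f : tw_one f = [exists x, f == idm C x]%:R.
Proof.
rewrite /tw_one sum_ffunE; case: existsP => [[x /eqP ->]|nx].
  rewrite (bigD1 x) //= big1 => [|y ne]; rewrite !ffunE ?eqxx ?addr0 //.
  by rewrite (inj_eq (can_inj (src_idm C))) eq_sym (negPf ne).
rewrite big1 // => x _; rewrite ffunE; case: eqP => // def_f.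
by case: nx; exists x; apply/eqP.
Qed.

Lemma tw_one_neq0 : inhabited O -> tw_one != 0.
Proof.
case=> x; apply/eqP => /ffunP/(_ (idm C x)); rewrite tw_oneE ffunE.
by case: existsP => [_ /eqP|[]]; [rewrite oner_eq0 | exists x].
Qed.

(* The tensor product of two linear forms, as a linear form on the tensor     *)
(* square.                                                                    *)
Definition tw_tensor (u v : 'Hom({ffun A -> K^o}, K^o)) :
    {ffun A * A -> K^o} -> K^o :=
  lext (fun p => (u (bas K p.1) : K) * v (bas K p.2) : K^o).

Definition tw_conv (u v : 'Hom({ffun A -> K^o}, K^o)) :
    'Hom({ffun A -> K^o}, K^o) :=
  linfun (tw_tensor u v \o tw_comul).
Definition tw_conv_one : 'Hom({ffun A -> K^o}, K^o) := linfun tw_counit.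

Definition tw_coord (u : 'Hom({ffun A -> K^o}, K^o)) : {ffun A -> K^o} :=
  [ffun f => u (bas K f)].

Lemma tw_coord_inj : injective tw_coord.
Proof.
move=> u v /ffunP uv; apply/lfunP; apply: eq_on_bas => f.
by have := uv f; rewrite !ffunE.
Qed.

Lemma tw_coord_linear : linear tw_coord.
Proof. by move=> a u v; apply/ffunP => f; rewrite !ffunE !lfunE /= lfunE. Qed.

Lemma tw_coord_conv u v :
  tw_coord (tw_conv u v) = tw_mul (tw_coord u) (tw_coord v).
Proof.
apply/ffunP => f; rewrite ffunE lfunE /= /tw_comul lext_bas.
rewrite (linear_sum (lext _)) tw_mulE sum_ffunE.
under [RHS]eq_bigr => g _ do rewrite sum_ffunE.
rewrite [RHS]pair_big big_mkcond /=; apply: eq_bigr => -[g h] _ /=.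
rewrite !ffunE /tw_basmul; case: eqP => _ /=; last by rewrite ffunE scaler0.
rewrite !ffunE [f == _]eq_sym; case: eqP => _; last by rewrite !scaler0.
rewrite linearZ /= lext_bas /= /GRing.scale /= mulr1.
by rewrite mulrC.
Qed.

Lemma tw_coord_conv_one : tw_coord tw_conv_one = tw_one.
Proof. by apply/ffunP => f; rewrite ffunE lfunE /= lext_bas tw_oneE. Qed.

End Twisted.

Section QuantumGroupoid.
Context (K : fieldType) (B H V P : finType) (T : double_groupoid B H V P).

Definition qgroupoid of cocycle2 K T : Type := {ffun B -> K^o}.

Context (c : cocycle2 K T).

HB.instance Definition _ := Vector.copy (qgroupoid c) {ffun B -> K^o}.

Definition box (A : B) : qgroupoid c := bas K A.

Definition qmul : qgroupoid c -> qgroupoid c -> qgroupoid c :=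
  tw_mul (vcat T) (sigma c).
Definition qone : qgroupoid c := tw_one K (vcat T).
Definition qcomul : qgroupoid c -> {ffun B * B -> K^o} :=
  tw_comul (hcat T) (tau c).
Definition qcounit : qgroupoid c -> K^o := tw_counit (hcat T).
Definition antipode : qgroupoid c -> qgroupoid c :=
  lext (fun A => ((tau c A (hinv T A))^-1
                  * (sigma c (dinv T A) (hinv T A))^-1) *: box (dinv T A)).

Lemma qmulA : associative qmul.
Proof. exact: tw_mulA (@sigma_cocycle _ _ _ _ _ _ c). Qed.
Lemma qmul1x : left_id qone qmul.
Proof. exact: tw_mul1x (@sigma_vidl _ _ _ _ _ _ c). Qed.
Lemma qmulx1 : right_id qone qmul.
Proof. exact: tw_mulx1 (@sigma_vidr _ _ _ _ _ _ c). Qed.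
Lemma qmulDl : left_distributive qmul +%R. Proof. exact: tw_mulDl. Qed.
Lemma qmulDr : right_distributive qmul +%R. Proof. exact: tw_mulDr. Qed.
Lemma qone_neq0 : qone != 0.
Proof. by apply: tw_one_neq0; case: (nonempty_sets T). Qed.
Lemma qscaleAl (a : K) (x y : qgroupoid c) : a *: qmul x y = qmul (a *: x) y.
Proof. by rewrite /qmul tw_mulZl. Qed.
Lemma qscaleAr (a : K) (x y : qgroupoid c) : a *: qmul x y = qmul x (a *: y).
Proof. by rewrite /qmul tw_mulZr. Qed.

HB.instance Definition _ := GRing.Zmodule_isNzRing.Build (qgroupoid c)
  qmulA qmul1x qmulx1 qmulDl qmulDr qone_neq0.
HB.instance Definition _ := GRing.Lmodule_isLalgebra.Build K (qgroupoid c) qscaleAl.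
HB.instance Definition _ := GRing.Lalgebra_isAlgebra.Build K (qgroupoid c) qscaleAr.
HB.instance Definition _ := Algebra_isFalgebra.Build K (qgroupoid c).

Lemma box_mul A C :
  box A * box C =
  if bot T A == top T C then sigma c A C *: box (vcomp T A C) else 0.
Proof. exact: tw_mul_bas. Qed.

Lemma qoneE : 1 = \sum_x box (vid T x) :> qgroupoid c.
Proof. by []. Qed.

Lemma qcomul_box A :
  qcomul (box A) =
  \sum_(p : B * B | (rgt T p.1 == lft T p.2) && (hcomp T p.1 p.2 == A))
    tau c p.1 p.2 *: bas K p.
Proof. exact: lext_bas. Qed.

Lemma qcounit_box A : qcounit (box A) = [exists g, A == hid T g]%:R.
Proof. exact: lext_bas. Qed.

Lemma antipode_box A :
  antipode (box A) =
  ((tau c A (hinv T A))^-1 * (sigma c (dinv T A) (hinv T A))^-1) *: box (dinv T A).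
Proof. exact: lext_bas. Qed.

(* The dual of the coalgebra: linear forms under convolution.                 *)
Definition qdual : Type := 'Hom(qgroupoid c, K^o).
HB.instance Definition _ := Vector.copy qdual 'Hom(qgroupoid c, K^o).

Definition dmul : qdual -> qdual -> qdual :=
  fun u v => linfun (tw_tensor u v \o qcomul).
Definition dunit : qdual := linfun qcounit.

Let coord (u : qdual) : {ffun B -> K^o} := tw_coord u.
Let coordM u v : coord (dmul u v) = tw_mul (hcat T) (tau c) (coord u) (coord v).
Proof. exact: tw_coord_conv. Qed.
Let coord1 : coord dunit = tw_one K (hcat T).
Proof. exact: tw_coord_conv_one. Qed.
Let coord_inj : injective coord. Proof. exact: tw_coord_inj. Qed.
Let coordP a (u v : qdual) : coord (a *: u + v) = a *: coord u + coord v.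
Proof. exact: tw_coord_linear. Qed.
Let coordD (u v : qdual) : coord (u + v) = coord u + coord v.
Proof. by rewrite -[u]scale1r coordP !scale1r. Qed.
Let coord0 : coord 0 = 0.
Proof. by apply: (addrI (coord 0)); rewrite -coordD !addr0. Qed.
Let coordZ a (u : qdual) : coord (a *: u) = a *: coord u.
Proof. by rewrite -[a *: u]addr0 coordP coord0 addr0. Qed.

Lemma dmulA : associative dmul.
Proof.
move=> u v w; apply: coord_inj; rewrite !coordM.
exact: tw_mulA (@tau_cocycle _ _ _ _ _ _ c) _ _ _.
Qed.
Lemma dmul1x : left_id dunit dmul.
Proof.
move=> u; apply: coord_inj; rewrite coordM coord1.
exact: tw_mul1x (@tau_hidl _ _ _ _ _ _ c) _.
Qed.
Lemma dmulx1 : right_id dunit dmul.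
Proof.
move=> u; apply: coord_inj; rewrite coordM coord1.
exact: tw_mulx1 (@tau_hidr _ _ _ _ _ _ c) _.
Qed.
Lemma dmulDl : left_distributive dmul +%R.
Proof.
by move=> u v w; apply: coord_inj; rewrite coordD !coordM coordD tw_mulDl.
Qed.
Lemma dmulDr : right_distributive dmul +%R.
Proof.
by move=> u v w; apply: coord_inj; rewrite coordD !coordM coordD tw_mulDr.
Qed.
Lemma dunit_neq0 : dunit != 0.
Proof.
apply/eqP => /(congr1 coord); rewrite coord1 coord0; apply/eqP.
by apply: tw_one_neq0; case: (nonempty_sets T).
Qed.
Lemma dscaleAl (a : K) (u v : qdual) : a *: dmul u v = dmul (a *: u) v.
Proof. by apply: coord_inj; rewrite coordZ !coordM coordZ tw_mulZl. Qed.
Lemma dscaleAr (a : K) (u v : qdual) : a *: dmul u v = dmul u (a *: v).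
Proof. by apply: coord_inj; rewrite coordZ !coordM coordZ tw_mulZr. Qed.

HB.instance Definition _ := GRing.Zmodule_isNzRing.Build qdual
  dmulA dmul1x dmulx1 dmulDl dmulDr dunit_neq0.
HB.instance Definition _ := GRing.Lmodule_isLalgebra.Build K qdual dscaleAl.
HB.instance Definition _ := GRing.Lalgebra_isAlgebra.Build K qdual dscaleAr.
HB.instance Definition _ := Algebra_isFalgebra.Build K qdual.

Lemma qdual_mulE (u v : qdual) x : (u * v : 'Hom(_, _)) x = tw_tensor u v (qcomul x).
Proof. exact: lfunE. Qed.

Lemma qdual_oneE x : ((1 : qdual) : 'Hom(_, _)) x = qcounit x.
Proof. exact: lfunE. Qed.

End QuantumGroupoid.

Section Semisimple.
Context (K : fieldType) (A : falgType K).

Definition left_ideal (I : {vspace A}) : bool := (fullv * I <= I)%VS.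

Definition simple_left_ideal (I : {vspace A}) : Prop :=
  [/\ left_ideal I, I != 0%VS &
      forall J : {vspace A}, left_ideal J -> (J <= I)%VS -> J = 0%VS \/ J = I].

(* A is semisimple as a left module over itself: a direct sum of simple left  *)
(* ideals (finitely many, since A is finite-dimensional).                     *)
Definition semisimple : Prop :=
  exists n (I : 'I_n -> {vspace A}),
    [/\ forall i, simple_left_ideal (I i), directv (\sum_i I i)
      & (\sum_i I i)%VS = fullv].

End Semisimple.

Definition cosemisimple (K : fieldType) (B H V P : finType)
    (T : double_groupoid B H V P) (c : cocycle2 K T) : Prop :=
  semisimple (qdual c).

(* Main.v *)
From HB Require Import structures.
From Stdlib Require Import Classical.
From mathcomp Require Import all_boot ssralg vector falgebra.
Require Import Defs.

(** For [S^2 = id] one needs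
    [tau(A,A^h) sigma(A^{-1},A^h) tau(A^{-1},A^v) sigma(A,A^v) = 1].
    The compatibility of [sigma] and [tau] on the square with rows [A, A^h]
    and [A^v, A^{-1}] equates this product with a value of [sigma] on two
    horizontal identities times a value of [tau] on two vertical identities,
    and the compatibility axiom forces both of these to be [1].
    Both the algebra and its dual are groupoid algebras twisted by a
    2-cocycle, and such an algebra is semisimple in characteristic [0] by
    Maschke's averaging argument, carried out over the arrows with a common
    source. *)

Set Implicit Arguments.
Unset Strict Implicit.
Unset Printing Implicit Defensive.

Import GRing.Theory.
Local Open Scope ring_scope.

(** * Inverses in a groupoid *)

Section Groupoid.
Context (O A : Type) (C : category O A) (inv : A -> A).
Hypothesis invP : inverse_op C inv.

Lemma src_inv f : src C (inv f) = tgt C f. Proof. by case: (invP f). Qed.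
Lemma tgt_inv f : tgt C (inv f) = src C f. Proof. by case: (invP f). Qed.
Lemma comp_invr f : catcomp C f (inv f) = idm C (src C f).
Proof. by case: (invP f). Qed.
Lemma comp_invl f : catcomp C (inv f) f = idm C (tgt C f).
Proof. by case: (invP f). Qed.

Lemma compKV f g : tgt C f = src C g -> catcomp C (inv f) (catcomp C f g) = g.
Proof.
by move=> fg; rewrite -catcompA ?tgt_inv // comp_invl fg comp_idl.
Qed.

Lemma compVK f g : src C f = src C g -> catcomp C f (catcomp C (inv f) g) = g.
Proof.
by move=> fg; rewrite -catcompA ?src_inv ?tgt_inv // comp_invr fg comp_idl.
Qed.

(** A right inverse is already the inverse; the identities between inverses below are obtained this
    way from a single composite. *)
Lemma inv_unique f g :
  tgt C f = src C g -> catcomp C f g = idm C (src C f) -> g = inv f.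
Proof.
by move=> fg e; rewrite -[LHS](compKV fg) e -(tgt_inv f) comp_idr.
Qed.

Lemma invK : involutive inv.
Proof.
move=> f; apply: esym; apply: inv_unique; first by rewrite tgt_inv.
by rewrite comp_invl src_inv.
Qed.

Lemma inv_comp f g : tgt C f = src C g ->
  inv (catcomp C f g) = catcomp C (inv g) (inv f).
Proof.
move=> fg; apply: esym; apply: inv_unique.
  by rewrite tgt_comp // src_comp ?src_inv ?tgt_inv.
rewrite catcompA ?src_comp ?src_inv ?tgt_inv ?tgt_comp //.
by rewrite compVK ?src_inv // comp_invr.
Qed.

End Groupoid.

(** * Inverses of boxes in a double groupoid *)

Section DoubleGroupoidInverses.
Context (B H V P : Type) (T : double_groupoid B H V P).

Let viP := vinvP T.
Let hiP := hinvP T.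

Lemma top_vinv A : top T (vinv T A) = bot T A. Proof. exact: src_inv viP A. Qed.
Lemma lft_hinv A : lft T (hinv T A) = rgt T A. Proof. exact: src_inv hiP A. Qed.
Lemma vcomp_vinvr A : vcomp T A (vinv T A) = vid T (top T A).
Proof. exact: comp_invr viP A. Qed.
Lemma hcomp_hinvr A : hcomp T A (hinv T A) = hid T (lft T A).
Proof. exact: comp_invr hiP A. Qed.

(** [A] on top of [vinv T A] is a vertical identity; its left edge exhibits a right inverse of
    [lft T A]. *)
Lemma lft_vinv A : lft T (vinv T A) = vedge_inv T (lft T A).
Proof.
have AV : bot T A = top T (vinv T A) by rewrite top_vinv.
apply: (inv_unique (vedge_invP T)).
  by rewrite -[tgt _ _]/(vb T _) -[src _ _]/(vt T _) corner_bl AV corner_tl.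
by rewrite -lft_vcomp // vcomp_vinvr lft_vid -corner_tl.
Qed.

Lemma rgt_vinv A : rgt T (vinv T A) = vedge_inv T (rgt T A).
Proof.
have AV : bot T A = top T (vinv T A) by rewrite top_vinv.
apply: (inv_unique (vedge_invP T)).
  by rewrite -[tgt _ _]/(vb T _) -[src _ _]/(vt T _) corner_br AV corner_tr.
by rewrite -rgt_vcomp // vcomp_vinvr rgt_vid -corner_tr.
Qed.

Lemma vinv_hid g : vinv T (hid T g) = hid T (vedge_inv T g).
Proof.
have tb : vb T g = vt T (vedge_inv T g).
  exact: esym (src_inv (vedge_invP T) g).
apply: esym; apply: (inv_unique viP).
  by rewrite -[tgt _ _]/(bot T _) -[src _ _]/(top T _) bot_hid top_hid tb.
rewrite -[catcomp _ _ _]/(vcomp T _ _) vcomp_hid //.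
rewrite (comp_invr (vedge_invP T)) -[src _ (hid T g)]/(top T _) top_hid.
by rewrite -vid_hid.
Qed.

Lemma rgt_lft_vinv_hinv A : rgt T (vinv T A) = lft T (vinv T (hinv T A)).
Proof. by rewrite rgt_vinv lft_vinv lft_hinv. Qed.

(** By interchange, the row [A, A^h] on top of the row [A^v, A^{-1}] is a vertical identity, so the
    lower row is the vertical inverse of [hid T (lft T A)]. *)
Lemma hcomp_vinv_hinv A :
  hcomp T (vinv T A) (vinv T (hinv T A)) = hid T (vedge_inv T (lft T A)).
Proof.
have AA : rgt T A = lft T (hinv T A) by rewrite lft_hinv.
have VV := rgt_lft_vinv_hinv A.
rewrite -vinv_hid -hcomp_hinvr; apply: (inv_unique viP).
  rewrite -[tgt _ _]/(bot T _) -[src _ _]/(top T _).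
  by rewrite bot_hcomp // top_hcomp // !top_vinv.
rewrite -[catcomp _ _ _]/(vcomp T _ _) interchange_law ?top_vinv //.
rewrite !vcomp_vinvr -[src _ _]/(top T _) top_hcomp //.
by rewrite hcomp_vid // -corner_tr AA corner_tl.
Qed.

Lemma hinv_vinv A : hinv T (vinv T A) = vinv T (hinv T A).
Proof.
apply: esym; apply: (inv_unique hiP); first exact: rgt_lft_vinv_hinv.
by rewrite -[catcomp _ _ _]/(hcomp T _ _) hcomp_vinv_hinv -lft_vinv.
Qed.

Lemma hinv_dinv A : hinv T (dinv T A) = vinv T A.
Proof. by rewrite /dinv -hinv_vinv (invK hiP). Qed.

Lemma dinvK : involutive (dinv T).
Proof. by move=> A; rewrite {1}/dinv hinv_dinv (invK viP). Qed.

End DoubleGroupoidInverses.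

(** * Values of a groupoid 2-cocycle at inverses *)

Section TwistedCocycle.
Context (K : fieldType) (O A : Type) (C : category O A) (inv : A -> A).
Context (s : A -> A -> K).
Hypothesis invP : inverse_op C inv.
Hypothesis sA : forall f g h, tgt C f = src C g -> tgt C g = src C h ->
  s f g * s (catcomp C f g) h = s g h * s f (catcomp C g h).
Hypothesis s1l : forall x f, tgt C (idm C x) = src C f -> s (idm C x) f = 1.
Hypothesis s1r : forall x f, tgt C f = src C (idm C x) -> s f (idm C x) = 1.

(** The cocycle identity for the triple [f, inv f, f]. *)
Lemma cocycle_invC f : s f (inv f) = s (inv f) f.
Proof.
have := sA (esym (src_inv invP f)) (tgt_inv invP f).
rewrite comp_invr // comp_invl // s1l ?s1r ?src_idm ?tgt_idm //.
by rewrite !mulr1.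
Qed.

(** Combines the cocycle identities for [g, k, inv h] and [k, inv h, g]; it serves to compare the
    weights in Maschke's averaging. *)
Lemma cocycle_inv_transfer g h (k := catcomp C (inv g) h) : src C g = src C h ->
  s g k * s h (inv h) = s (inv h) g * s k (inv k).
Proof.
move=> gh; rewrite {}/k; set k := catcomp C _ _.
have kh : tgt C (inv g) = src C h by rewrite tgt_inv.
have sk : src C k = tgt C g by rewrite src_comp ?src_inv.
have tk : tgt C k = tgt C h by rewrite tgt_comp.
have ik : inv k = catcomp C (inv h) g by rewrite inv_comp // (invK invP).
have gkh : catcomp C g k = h by rewrite compVK.
have khi : catcomp C k (inv h) = inv g.
  by rewrite catcompA ?src_inv // comp_invr // -gh -(tgt_inv invP g) comp_idr.
have ki : tgt C k = src C (inv h) by rewrite src_inv.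
have gk : tgt C g = src C k by [].
have ig : tgt C (inv h) = src C g by rewrite tgt_inv.
have := sA gk ki; rewrite gkh khi => ->.
by rewrite cocycle_invC; have := sA ki ig; rewrite khi -ik.
Qed.

End TwistedCocycle.

(** * The square of the antipode *)

Section Antipode.
Context (K : fieldType) (B H V P : finType) (T : double_groupoid B H V P).
Context (c : cocycle2 K T).

(* The compatibility of sigma and tau on the square with rows [hid g, hid g]
   and [hid h, hid h] reads [sigma = sigma ^+ 2]. *)
Lemma sigma_hid g h : vb T g = vt T h -> sigma c (hid T g) (hid T h) = 1.
Proof.
move=> gh.
have gg e : rgt T (hid T e) = lft T (hid T e).
  by rewrite /rgt /lft tgt_idm src_idm.
have bt : bot T (hid T g) = top T (hid T h) by rewrite bot_hid top_hid gh.
have hh e : hcomp T (hid T e) (hid T e) = hid T e.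
  by rewrite -{1}[e](src_idm (hcat T)) [LHS]comp_idl.
have := sigma_tau c (gg g) (gg h) bt bt.
rewrite !hh vcomp_hid // !tau_hidl // !mul1r mulr1 => /esym e.
by apply: (mulfI (sigma_neq0 c bt)); rewrite e mulr1.
Qed.

(** On the square with both rows [vid x, vid y], compatibility reads [tau = tau ^+ 2]. *)
Lemma tau_vid x y : hr T x = hl T y -> tau c (vid T x) (vid T y) = 1.
Proof.
move=> xy.
have bt e : bot T (vid T e) = top T (vid T e).
  by rewrite /top /bot tgt_idm src_idm.
have gg : rgt T (vid T x) = lft T (vid T y) by rewrite rgt_vid lft_vid xy.
have vv e : vcomp T (vid T e) (vid T e) = vid T e.
  by rewrite -{1}[e](src_idm (vcat T)) [LHS]comp_idl.
have := sigma_tau c gg gg (bt x) (bt y).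
rewrite !vv hcomp_vid // !sigma_vidl // !mulr1 mul1r => /esym e.
by apply: (mulfI (tau_neq0 c gg)); rewrite e mulr1.
Qed.

(** The two halves of the product are the denominators in [S(A)] and [S(A^{-1})]. *)
Lemma antipode_coef_inv A :
  tau c A (hinv T A) * sigma c (dinv T A) (hinv T A) *
  (tau c (dinv T A) (vinv T A) * sigma c A (vinv T A)) = 1.
Proof.
have AA : rgt T A = lft T (hinv T A) by rewrite lft_hinv.
have := sigma_tau c AA (rgt_lft_vinv_hinv T A) (esym (top_vinv T A))
          (esym (top_vinv T (hinv T A))).
rewrite hcomp_hinvr hcomp_vinv_hinv !vcomp_vinvr sigma_hid; last first.
  exact: esym (src_inv (vedge_invP T) _).
rewrite tau_vid; last by rewrite -corner_tr AA corner_tl.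
(* The [1] on the right becomes the compatibility product, in which one [sigma] and one [tau] have
   their two mutually inverse arguments in the other order. *)
rewrite mulr1 -[vinv T (hinv T A)]/(dinv T A) => ->.
have -> : sigma c (dinv T A) (hinv T A) = sigma c (hinv T A) (dinv T A).
  exact: esym (cocycle_invC (vinvP T) (@sigma_cocycle _ _ _ _ _ _ c)
    (@sigma_vidl _ _ _ _ _ _ c) (@sigma_vidr _ _ _ _ _ _ c) (hinv T A)).
have -> : tau c (dinv T A) (vinv T A) = tau c (vinv T A) (dinv T A).
  rewrite /dinv -hinv_vinv.
  exact: esym (cocycle_invC (hinvP T) (@tau_cocycle _ _ _ _ _ _ c)
    (@tau_hidl _ _ _ _ _ _ c) (@tau_hidr _ _ _ _ _ _ c) (vinv T A)).
by rewrite -!mulrA; congr (_ * _); rewrite mulrCA; congr (_ * _); rewrite mulrC.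
Qed.

Lemma antipodeK : involutive (@antipode K B H V P T c).
Proof.
move=> x; rewrite -[RHS]lext_id /antipode {2}/lext linear_sum.
apply: eq_bigr => A _; rewrite linearZ linearZ /= lext_bas; congr (_ *: _).
rewrite hinv_dinv dinvK scalerA -!invfM antipode_coef_inv invr1 scale1r //.
Qed.

End Antipode.

(** * Separability and complete reducibility *)

Section Separable.
Context (K : fieldType) (A : falgType K).
Implicit Types I J : {vspace A}.

Lemma left_idealP I :
  reflect (forall x y, y \in I -> x * y \in I) (left_ideal I).
Proof.
by apply: (iffP prodvP) => [h x y|h x y _]; [apply: h; rewrite ?memvf | apply: h].
Qed.

(** Complements are taken inside an arbitrary left ideal [I], so that an induction on dimension can
    split each summand again. *)
Definition complemented_left_ideals : Prop :=
  forall I J, left_ideal I -> left_ideal J -> (J <= I)%VS ->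
  exists J', [/\ left_ideal J', (J + J')%VS = I & (J :&: J')%VS = 0%VS].

(* The second hypothesis says that [\sum_i a i (x) b i] commutes with [x] in
   the bimodule [A (x) A], tested against the maps [u (x) v |-> u * f v]. *)
Lemma separable_complemented (X : finType) (a b : X -> A) :
  \sum_i a i * b i = 1 ->
  (forall (f : 'End(A)) x,
     \sum_i x * a i * f (b i) = \sum_i a i * f (b i * x)) ->
  complemented_left_ideals.
Proof.
move=> ab1 abx I J /left_idealP idI /left_idealP idJ sJI.
(* Averages the merely [K]-linear projection onto [J] into an [A]-linear one. *)
pose p : 'End(A) := (\sum_i (amull (a i) \o projv J \o amull (b i)))%VF.
have pE y : p y = \sum_i a i * projv J (b i * y).
  by rewrite sum_lfunE; apply: eq_bigr => i _; rewrite !comp_lfunE !lfunE.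
have pM x y : p (x * y) = x * p y.
  rewrite !pE mulr_sumr; have := abx (projv J \o amulr y)%VF x.
  under eq_bigr => i _ do rewrite comp_lfunE lfunE /= -mulrA.
  by move=> ->; apply: eq_bigr => i _; rewrite comp_lfunE lfunE /= mulrA.
have pJ y : p y \in J.
  by rewrite pE rpred_sum // => i _; apply/idJ/memv_proj.
have p_id y : y \in J -> p y = y.
  move=> Jy; rewrite pE -[RHS]mul1r -ab1 mulr_suml; apply: eq_bigr => i _.
  by rewrite projv_id ?mulrA // idJ.
exists (I :&: lker p)%VS; split.
- apply/left_idealP => x y; rewrite !memv_cap !memv_ker => /andP[Iy /eqP py].
  by rewrite idI // pM py mulr0 eqxx.
- apply/eqP; rewrite eqEsubv subv_add sJI capvSl /=.
  apply/subvP => y Iy; rewrite -[y](subrK (p y)) addrC memv_add //.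
  rewrite memv_cap memv_ker linearB /= (p_id _ (pJ y)) subrr eqxx andbT.
  by rewrite rpredB // (subvP sJI).
- apply/eqP; rewrite -subv0; apply/subvP => y.
  rewrite memv_cap => /andP[Jy]; rewrite memv_cap memv_ker => /andP[_].
  by rewrite p_id // memv0.
Qed.

(** Induction on dimension: a nonzero left ideal that is not simple splits into two of smaller
    dimension, whose decompositions are concatenated. *)
Lemma complemented_semisimple : complemented_left_ideals -> semisimple A.
Proof.
move=> cpl.
suff decomp d I : (\dim I < d)%N -> left_ideal I ->
    exists n (F : 'I_n -> {vspace A}),
    [/\ forall i, simple_left_ideal (F i), directv (\sum_i F i)
      & (\sum_i F i)%VS = I].
  by apply: (decomp _ fullv (ltnSn _)); apply/left_idealP => *; apply: memvf.
elim: d I => // d IHd I dimI idI.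
have [->|nzI] := eqVneq I 0%VS.
  exists 0, (fun _ => 0%VS); split; first by case.
    by rewrite directvE /= !big_ord0 dimv0.
  by rewrite big_ord0.
(* Simplicity quantifies over all subspaces, hence the classical case split. *)
have [simI|nsimI] := classic (simple_left_ideal I).
  exists 1, (fun _ => I); split=> //; rewrite ?big_ord1 //.
  by rewrite directvE /= !big_ord1.
have [J [idJ sJI nzJ neJI]] : exists J,
    [/\ left_ideal J, (J <= I)%VS, J != 0%VS & J != I].
  apply: NNPP => noJ; case: nsimI; split=> // J idJ sJI.
  case: (eqVneq J 0%VS) => [->|nzJ]; [by left | right; apply/eqP].
  by apply/negPn/negP => neJI; case: noJ; exists J.
have [J' [idJ' sumJ capJ]] := cpl _ _ idI idJ sJI.
have dimJJ' : \dim I = (\dim J + \dim J')%N.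
  by rewrite -sumJ dimv_disjoint_sum.
have dimJ_gt0 : (0 < \dim J)%N by rewrite lt0n dimv_eq0.
have dimJ'_gt0 : (0 < \dim J')%N.
  rewrite lt0n dimv_eq0; apply: contraNneq neJI => J'0.
  by rewrite -sumJ J'0 addv0.
have [|n [F [simF dirF sumF]]] := IHd J _ idJ.
  by rewrite -ltnS; apply: leq_ltn_trans dimI; rewrite dimJJ' -addn1 leq_add2l.
have [|m [G [simG dirG sumG]]] := IHd J' _ idJ'.
  by rewrite -ltnS; apply: leq_ltn_trans dimI; rewrite dimJJ' -add1n leq_add2r.
pose FG i := match split i with inl j => F j | inr j => G j end.
have FGl i : FG (lshift m i) = F i.
  by rewrite /FG -[lshift m i]/(unsplit (inl i)) unsplitK.
have FGr i : FG (rshift n i) = G i.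
  by rewrite /FG -[rshift n i]/(unsplit (inr i)) unsplitK.
have sumFG : (\sum_i FG i)%VS = I.
  rewrite big_split_ord /= (eq_bigr _ (fun i _ => FGl i)).
  by rewrite (eq_bigr _ (fun i _ => FGr i)) sumF sumG.
exists (n + m)%N, FG; split=> //.
  by move=> i; rewrite /FG; case: split => j.
(* Directness is checked by counting dimensions. *)
move: dirF dirG; rewrite !directvE /= sumFG sumF sumG => /eqP dF /eqP dG.
rewrite dimJJ' dF dG big_split_ord /=; apply/eqP.
by congr (_ + _)%N; apply: eq_bigr => i _; rewrite ?FGl ?FGr.
Qed.

End Separable.

(** * Maschke's argument for twisted groupoid algebras *)

Section TwistedGroupoidAlgebra.
Context (K : fieldType) (O X : finType) (C : category O X) (inv : X -> X).
Context (s : X -> X -> K).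
Hypothesis invP : inverse_op C inv.
Hypothesis s_neq0 : forall f g, tgt C f = src C g -> s f g != 0.
Hypothesis sA : forall f g h, tgt C f = src C g -> tgt C g = src C h ->
  s f g * s (catcomp C f g) h = s g h * s f (catcomp C g h).
Hypothesis s1l : forall x f, tgt C (idm C x) = src C f -> s (idm C x) f = 1.
Hypothesis s1r : forall x f, tgt C f = src C (idm C x) -> s f (idm C x) = 1.

(** Left composition with [g] is a bijection with inverse given by [inv g]. The operation is generic
    in order to cover both counting arrows and summing in the algebra. *)
Lemma reindex_lcomp (R : Type) (idx : R) (op : Monoid.com_law idx) g (F : X -> R) :
  \big[op/idx]_(f | src C f == tgt C g) F (catcomp C g f) =
  \big[op/idx]_(h | src C h == src C g) F h.
Proof.
rewrite [RHS](reindex_onto (catcomp C g) (catcomp C (inv g))) => [|h /eqP hg].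
  apply: eq_bigl => f; apply/eqP/andP => [fg|[/eqP e /eqP fg]].
    by rewrite src_comp // (compKV invP) // !eqxx.
  by rewrite -fg src_comp ?(tgt_inv invP) // (src_inv invP).
by rewrite (compVK invP).
Qed.

(** Stands in for the group order of Maschke's theorem. *)
Definition out_degree (x : O) := #|[pred f | src C f == x]|.

Lemma out_degree_gt0 x : (0 < out_degree x)%N.
Proof. by apply/card_gt0P; exists (idm C x); rewrite inE src_idm. Qed.

Lemma out_degree_tgt g : out_degree (tgt C g) = out_degree (src C g).
Proof. by rewrite /out_degree -!sum1_card (reindex_lcomp _ g (fun=> 1%N)). Qed.

(** The algebra enters through a spanning family with twisted products, so that one argument serves
    both the quantum groupoid and its dual. *)
Context (A : falgType K) (e : X -> A).
Hypothesis eM : forall f g, e f * e g =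
  if tgt C f == src C g then s f g *: e (catcomp C f g) else 0.
Hypothesis e1 : 1 = \sum_x e (idm C x).
Hypothesis e_span : forall x, exists k : X -> K, x = \sum_f k f *: e f.

(* Maschke: averaging over the arrows with a common source; the element
   [\sum_f a f (x) e (inv f)] is a separability idempotent. *)
Lemma twisted_groupoid_algebra_semisimple :
  [pchar K] =i pred0 -> semisimple A.
Proof.
move=> /pcharf0P char0.
(* The factor [s f (inv f)] cancels the twist in [e f * e (inv f)]; the degree cancels the number of
   such terms. *)
pose w f := ((out_degree (src C f))%:R * s f (inv f))^-1.
have s_inv f : s f (inv f) != 0 by rewrite s_neq0 ?(src_inv invP).
have deg_neq0 x : (out_degree x)%:R != 0 :> K.
  by rewrite char0 -lt0n out_degree_gt0.
apply: complemented_semisimple.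
apply: (@separable_complemented _ _ X (fun f => w f *: e f) (e \o inv)).
  rewrite e1 (partition_big (src C) predT) //=; apply: eq_bigr => x _.
  transitivity (\sum_(f | src C f == x) (out_degree x)%:R^-1 *: e (idm C x)).
    apply: eq_bigr => f /eqP fx.
    rewrite -scalerAl eM (src_inv invP) eqxx (comp_invr invP) scalerA /w fx invfM.
    by rewrite mulfVK.
  by rewrite sumr_const -scaler_nat scalerA mulfV ?scale1r //; apply: deg_neq0.
(* Both sides are linear in [y], which reduces the identity to [y = e g]. *)
move=> phi y; have [k ->] := e_span y.
under eq_bigr => f _ do rewrite !mulr_suml.
under [RHS]eq_bigr => f _ do rewrite mulr_sumr linear_sum mulr_sumr.
rewrite exchange_big [RHS]exchange_big; apply: eq_bigr => g _ /=.
under eq_bigr => f _ do rewrite -!scalerAl.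
under [RHS]eq_bigr => f _ do rewrite -scalerAr linearZ -scalerAr /=.
rewrite -!scaler_sumr; congr (_ *: _).
(* The summand of the left side at [f], rewritten in terms of [h = g f]. *)
pose F h := (w (catcomp C (inv g) h) * s g (catcomp C (inv g) h)) *:
  (e h * phi (e (inv (catcomp C (inv g) h)))).
transitivity (\sum_(f | src C f == tgt C g) F (catcomp C g f)).
  rewrite [RHS]big_mkcond; apply: eq_bigr => f _.
  rewrite -scalerAr eM [tgt C g == _]eq_sym; case: eqP => [fg|_].
    by rewrite /F (compKV invP) // scalerA scalerAl.
  by rewrite scaler0 mul0r.
rewrite reindex_lcomp big_mkcond; apply: eq_bigr => h _.
rewrite eM (tgt_inv invP); case: eqP => [hg|_]; last by rewrite linear0 mulr0.
rewrite /F (inv_comp invP) ?(tgt_inv invP) // (invK invP) linearZ /=.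
rewrite -scalerAr -scalerAl.
(* With [k = g^{-1} h], it remains to compare [w k * s g k] with [w h * s (inv h) g]: the degrees
   agree, and the rest is [cocycle_inv_transfer]. *)
rewrite scalerA; congr (_ *: _); rewrite /w.
rewrite src_comp ?(tgt_inv invP) // (src_inv invP) out_degree_tgt -hg !invfM.
rewrite [RHS]mulrCA -mulrA [(s _ _)^-1 * _]mulrC; congr (_ * _); apply/eqP.
by rewrite eqr_div // (cocycle_inv_transfer invP sA s1l s1r (esym hg)).
Qed.

End TwistedGroupoidAlgebra.

(** * Coordinates on the dual and the conclusion *)

HB.instance Definition _ (K : fieldType) (X : finType) :=
  GRing.isLinear.Build K 'Hom({ffun X -> K^o}, K^o) {ffun X -> K^o} *:%R
    (@tw_coord K X) (@tw_coord_linear K X).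

Theorem proposition3p9 (K : fieldType) (B H V P : finType)
    (T : double_groupoid B H V P) (vacT : vacant T) (c : cocycle2 K T) :
  (forall x : qgroupoid c, antipode (antipode x) = x) /\
  ([pchar K] =i pred0 -> semisimple (qgroupoid c) /\ cosemisimple c).
Proof.
split=> [|char0]; first exact: antipodeK.
split.
- apply: (twisted_groupoid_algebra_semisimple (vinvP T) (@sigma_neq0 _ _ _ _ _ _ c)
    (@sigma_cocycle _ _ _ _ _ _ c) (@sigma_vidl _ _ _ _ _ _ c)
    (@sigma_vidr _ _ _ _ _ _ c) (box_mul c) (qoneE c)) => // x.
  by exists x; rewrite {1}[x]lextE.
(* The dual basis; its coordinates are the basis vectors, so it multiplies by horizontal composition
   twisted by [tau]. *)
pose e f : qdual c := linfun (lext (fun g => (f == g)%:R : K^o)).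
have coord_e f : tw_coord (e f) = bas K f.
  by apply/ffunP => g; rewrite !ffunE lfunE /= lext_bas eq_sym.
apply: (twisted_groupoid_algebra_semisimple (e := e) (hinvP T)
  (@tau_neq0 _ _ _ _ _ _ c)
  (@tau_cocycle _ _ _ _ _ _ c) (@tau_hidl _ _ _ _ _ _ c)
  (@tau_hidr _ _ _ _ _ _ c)) => //.
- move=> f g; apply: tw_coord_inj.
  rewrite [LHS]tw_coord_conv !coord_e tw_mul_bas /tw_basmul.
  by case: eqP => _; rewrite ?linear0 ?linearZ /= ?coord_e.
- apply: tw_coord_inj; rewrite [LHS]tw_coord_conv_one linear_sum.
  by apply: eq_bigr => x _; exact: esym (coord_e _).
- move=> u; exists (tw_coord u); apply: tw_coord_inj.
  rewrite linear_sum {1}[tw_coord u]lextE; apply: eq_bigr => f _.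
  by rewrite linearZ /=; congr (_ *: _); exact: esym (coord_e _).
Qed.
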